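(* Let $\boldsymbol{M}\in\mathbb{R}^{H\times N}$ be the delivery-time matrix of the network interdiction game on a directed graph $\mathcal{G}(\mathcal{N},\mathcal{E})$ with origin $O$ and destination $D$, i.e. $m_{hn}=l_{hn}\,p_n\,f^h(n)+f^h(D)$ for every simple path $h\in\mathcal{H}$ from $O$ to $D$ and every node $n\in\mathcal{N}$. Let $\hat{\boldsymbol{y}}^*$ be an optimal solution of the linear program $$(P_3):\quad \max_{\hat{\boldsymbol{y}}\in\mathbb{R}^H}\ \hat{\boldsymbol{y}}^T\boldsymbol{1}_H\quad\text{s.t.}\quad \boldsymbol{M}^T\hat{\boldsymbol{y}}\le \boldsymbol{1}_N,\ \hat{\boldsymbol{y}}\ge 0,$$ and let $\hat{\boldsymbol{x}}^*$ be an optimal solution of the linear program $$(P_4):\quad \min_{\hat{\boldsymbol{x}}\in\mathbb{R}^N}\ \hat{\boldsymbol{x}}^T\boldsymbol{1}_N\quad\text{s.t.}\quad \boldsymbol{M}\hat{\boldsymbol{x}}\ge \boldsymbol{1}_H,\ \hat{\boldsymbol{x}}\ge 0.$$ Let $\boldsymbol{y}^*=\hat{\boldsymbol{y}}^*/\big((\hat{\boldsymbol{y}}^* )^T\boldsymbol{1}_H\big)$ and $\boldsymbol{x}^*=\hat{\boldsymbol{x}}^*/\big((\hat{\boldsymbol{x}}^* )^T\boldsymbol{1}_N\big)$ be the corresponding solution strategies. Then $(\boldsymbol{y}^*,\boldsymbol{x}^* )$ is a mixed-strategy Nash equilibrium of the network interdiction game, and the optimal values $\mu_1(\hat{\boldsymbol{y}}^*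 )=(\hat{\boldsymbol{y}}^* )^T\boldsymbol{1}_H$ of $(P_3)$ and $\mu_2(\hat{\boldsymbol{x}}^* )=(\hat{\boldsymbol{x}}^* )^T\boldsymbol{1}_N$ of $(P_4)$ satisfy $$\mu_1(\hat{\boldsymbol{y}}^* )=\mu_2(\hat{\boldsymbol{x}}^* )=\frac{1}{T},$$ where $T=(\boldsymbol{y}^* )^T\boldsymbol{M}\boldsymbol{x}^*$ is the expected delivery time under the equilibrium $(\boldsymbol{y}^*,\boldsymbol{x}^* )$.
   Context: Setting. $\mathcal{G}(\mathcal{N},\mathcal{E})$ is a finite directed graph with set $\mathcal{N}$ of $N$ nodes (danger points, including two distinct nodes $O$, the origin, and $D$, the destination) and edge set $\mathcal{E}$. Each edge $e_k\in\mathcal{E}$ has a travel time $t_k>0$. Each node $n\in\mathcal{N}$ has an attack success probability $p_n\in[0,1]$. $\mathcal{H}$ is the set of simple directed paths (no repeated vertices) from $O$ to $D$; it is assumed nonempty and $H=|\mathcal{H}|$. Each path is identified with its sequence of traversed nodes, which includes $O$ and $D$. Notation. For $h\in\mathcal{H}$ and $n\in\mathcal{N}$, $l_{hn}=1$ if $n\in h$ and $l_{hn}=0$ otherwise. For $n\in h$, $f^h(n)$ is the time needed to reach $n$ from $O$ along $h$, i.e. the sum of the travel times of the edges of $h$ preceding $n$ (so $f^h(D)$ is the total travel time of $h$). When $n\notin h$ the term $l_{hn}p_nf^h(n)$ is $0$. $\boldsymbol{1}_N$ and $\boldsymbol{1}_H$ are the all-ones column vectors in $\mathbb{R}^N$ and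 $\mathbb{R}^H$; vector inequalities are componentwise. Game. The vendor (minimizer) chooses a mixed strategy $\boldsymbol{y}\in\mathcal{Y}=\{\boldsymbol{y}\in\mathbb{R}^H:\boldsymbol{y}\ge 0,\ \sum_{h}y_h=1\}$ over paths, and the attacker (maximizer) chooses a mixed strategy $\boldsymbol{x}\in\mathcal{X}=\{\boldsymbol{x}\in\mathbb{R}^N:\boldsymbol{x}\ge 0,\ \sum_n x_n=1\}$ over nodes. The expected delivery time under $(\boldsymbol{y},\boldsymbol{x})$ is $\boldsymbol{y}^T\boldsymbol{M}\boldsymbol{x}$, which the vendor minimizes and the attacker maximizes (a zero-sum game). Nash equilibrium (equivalently, saddle-point equilibrium). $(\boldsymbol{y}^*,\boldsymbol{x}^* )\in\mathcal{Y}\times\mathcal{X}$ is a mixed-strategy Nash equilibrium if and only if $(\boldsymbol{y}^* )^T\boldsymbol{M}\boldsymbol{x}^*\le \boldsymbol{y}^T\boldsymbol{M}\boldsymbol{x}^*$ for all $\boldsymbol{y}\in\mathcal{Y}$ and $(\boldsymbol{y}^* )^T\boldsymbol{M}\boldsymbol{x}^*\ge (\boldsymbol{y}^* )^T\boldsymbol{M}\boldsymbol{x}$ for all $\boldsymbol{x}\in\mathcal{X}$. *)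

(* Defs.v *)
From HB Require Import structures.
From mathcomp Require Import all_boot all_order all_algebra.

Set Implicit Arguments.
Unset Strict Implicit.
Unset Printing Implicit Defensive.

Import Order.TTheory GRing.Theory Num.Theory.
Local Open Scope ring_scope.

Section Paths.

Variables (V : finType) (edge : rel V).

(* A path is the sequence of the nodes it traverses, both endpoints included. *)
Definition simple_path (orig dest : V) (h : seq V) : bool :=
  if h is n :: q then
    [&& n == orig, path edge n q, last n q == dest & uniq h]
  else false.

(* Simple paths have at most #|V| nodes, so bounding the length loses none of
   them (simple_pathsP) and makes them a finite set. *)
Definition simple_paths (orig dest : V) : {set #|V|.-bseq V} :=
  [set h : #|V|.-bseq V | simple_path orig dest h].

Lemma simple_pathsP (orig dest : V) (h : seq V) :
  reflect (exists2 b : #|V|.-bseq V, b \in simple_paths orig dest & val b = h)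
          (simple_path orig dest h).
Proof.
apply: (iffP idP) => [hP|[b + <-]]; last by rewrite inE.
have uh : uniq h by case: h hP => //= n q /and4P[].
have sh : (size h <= #|V|)%N by rewrite -(card_uniqP uh) max_card.
by exists (Bseq sh); rewrite ?inE.
Qed.

End Paths.

Section Game.

Variable R : realFieldType.

(* The value is meaningful only for n \in h: otherwise index n h = size h and
   the last term of the sum reads past the end of h. *)
Definition reach_time (V : eqType) (time : V -> V -> R) (h : seq V) (n : V) : R :=
  \sum_(0 <= i < index n h) time (nth n h i) (nth n h i.+1).

(* Rows and columns are numbered by the standard enumerations of the simple
   paths and of the nodes. *)
Definition delivery_time_matrix (V : finType) (edge : rel V)
    (time : V -> V -> R) (p : V -> R) (orig dest : V) :
    'M[R]_(#|simple_paths edge orig dest|, #|V|) :=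
  \matrix_(i < #|simple_paths edge orig dest|, j < #|V|)
    let h : seq V := val (enum_val i) in
    let n : V := enum_val j in
    (n \in h)%:R * p n * reach_time time h n + reach_time time h dest.

Definition mx_le (m n : nat) (A B : 'M[R]_(m, n)) : Prop :=
  forall i j, A i j <= B i j.

Definition dot_ones (m : nat) (v : 'cV[R]_m) : R :=
  (v^T *m (const_mx 1 : 'cV[R]_m)) 0 0.

Definition mixed_strategy (m : nat) (v : 'cV[R]_m) : Prop :=
  mx_le 0 v /\ \sum_i v i 0 = 1.

Definition expected_time (m n : nat) (M : 'M[R]_(m, n))
    (y : 'cV[R]_m) (x : 'cV[R]_n) : R :=
  (y^T *m M *m x) 0 0.

(* The row player y minimizes, the column player x maximizes. *)
Definition nash_equilibrium (m n : nat) (M : 'M[R]_(m, n))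
    (y : 'cV[R]_m) (x : 'cV[R]_n) : Prop :=
  [/\ mixed_strategy y, mixed_strategy x,
      forall y', mixed_strategy y' -> expected_time M y x <= expected_time M y' x
    & forall x', mixed_strategy x' -> expected_time M y x' <= expected_time M y x].

Definition P3_feasible (m n : nat) (M : 'M[R]_(m, n)) (y : 'cV[R]_m) : Prop :=
  mx_le (M^T *m y) (const_mx 1) /\ mx_le 0 y.

Definition P3_optimal (m n : nat) (M : 'M[R]_(m, n)) (y : 'cV[R]_m) : Prop :=
  P3_feasible M y /\ forall y', P3_feasible M y' -> dot_ones y' <= dot_ones y.

Definition P4_feasible (m n : nat) (M : 'M[R]_(m, n)) (x : 'cV[R]_n) : Prop :=
  mx_le (const_mx 1) (M *m x) /\ mx_le 0 x.

Definition P4_optimal (m n : nat) (M : 'M[R]_(m, n)) (x : 'cV[R]_n) : Prop :=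
  P4_feasible M x /\ forall x', P4_feasible M x' -> dot_ones x <= dot_ones x'.

End Game.

(* Main.v *)
Require Import Defs.
From HB Require Import structures.
From mathcomp Require Import all_boot all_order all_algebra.

Set Implicit Arguments.
Unset Strict Implicit.
Unset Printing Implicit Defensive.

Import Order.TTheory GRing.Theory Num.Theory.
Local Open Scope ring_scope.

(** Weak duality gives [1^T yhat <= yhat^T M xhat <= 1^T xhat], and strong
    duality, derived from Farkas' lemma, makes the two ends equal to a common
    value [mu], which is positive because [M xhat >= 1] forces [xhat != 0].
    Hence [yhat^T M xhat = mu]; dividing the feasibility constraints of the two
    programs by [mu] says that [x] guarantees at least [1 / mu] to the attacker
    and [y] at most [1 / mu] to the vendor. *)

Section MatrixOrder.

Variable R : realFieldType.

Lemma mx_le_mul2l (m n k : nat) (A : 'M[R]_(m, n)) (B C : 'M[R]_(n, k)) :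
  mx_le 0 A -> mx_le B C -> mx_le (A *m B) (A *m C).
Proof.
move=> A_ge0 leBC i j; rewrite !mxE; apply: ler_sum => l _.
by apply: ler_wpM2l (leBC l j); have := A_ge0 i l; rewrite mxE.
Qed.

Lemma mx_le_mul2r (m n k : nat) (A : 'M[R]_(n, k)) (B C : 'M[R]_(m, n)) :
  mx_le 0 A -> mx_le B C -> mx_le (B *m A) (C *m A).
Proof.
move=> A_ge0 leBC i j; rewrite !mxE; apply: ler_sum => l _.
by apply: ler_wpM2r (leBC i l); have := A_ge0 l j; rewrite mxE.
Qed.

Lemma mx_le_tr (m n : nat) (A B : 'M[R]_(m, n)) : mx_le A B -> mx_le A^T B^T.
Proof. by move=> leAB i j; rewrite !mxE. Qed.

Lemma mx_le_tr0 (m n : nat) (A : 'M[R]_(m, n)) : mx_le 0 A -> mx_le 0 A^T.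
Proof. by move=> /mx_le_tr; rewrite trmx0. Qed.

Lemma mx_le_col_mx (m1 m2 n : nat) (A C : 'M[R]_(m1, n)) (B D : 'M[R]_(m2, n)) :
  mx_le (col_mx A B) (col_mx C D) <-> mx_le A C /\ mx_le B D.
Proof.
split=> [le|[leAC leBD] i j]; last first.
  by rewrite !mxE; case: (split i) => k.
by split=> i j; [have := le (lshift _ i) j | have := le (rshift _ i) j];
  rewrite ?col_mxEu ?col_mxEd.
Qed.

Lemma mx_le_row_mx (m n1 n2 : nat) (A C : 'M[R]_(m, n1)) (B D : 'M[R]_(m, n2)) :
  mx_le (row_mx A B) (row_mx C D) <-> mx_le A C /\ mx_le B D.
Proof.
split=> [le|[leAC leBD] i j]; last first.
  by rewrite !mxE; case: (split j) => k.
by split=> i j; [have := le i (lshift _ j) | have := le i (rshift _ j)];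
  rewrite ?row_mxEl ?row_mxEr.
Qed.

Lemma dot_onesE (m : nat) (v : 'cV[R]_m) : dot_ones v = \sum_i v i 0.
Proof. by rewrite /dot_ones mxE; apply: eq_bigr => i _; rewrite !mxE mulr1. Qed.

Lemma dot_onesC (m : nat) (v : 'cV[R]_m) :
  dot_ones v = ((const_mx 1 : 'cV[R]_m)^T *m v) 0 0.
Proof. by rewrite dot_onesE mxE; apply: eq_bigr => i _; rewrite !mxE mul1r. Qed.

Lemma dot_onesZ (m : nat) (a : R) (v : 'cV[R]_m) :
  dot_ones (a *: v) = a * dot_ones v.
Proof. by rewrite !dot_onesE mulr_sumr; apply: eq_bigr => i _; rewrite mxE. Qed.

Lemma dot_onesD (m : nat) (u v : 'cV[R]_m) :
  dot_ones (u + v) = dot_ones u + dot_ones v.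
Proof. by rewrite !dot_onesE -big_split; apply: eq_bigr => i _; rewrite mxE. Qed.

Lemma dot_ones_gt0 (m : nat) (v : 'cV[R]_m) :
  mx_le 0 v -> v != 0 -> 0 < dot_ones v.
Proof.
move=> v_ge0 v_neq0; have v0 i : 0 <= v i 0 by have := v_ge0 i 0; rewrite mxE.
rewrite dot_onesE lt_def sumr_ge0 ?andbT // psumr_eq0 //.
apply: contra v_neq0 => /allP v_eq0; apply/eqP/colP => i; rewrite mxE.
by apply/eqP/v_eq0; rewrite mem_index_enum.
Qed.

Lemma expected_timeZ (m n : nat) (M : 'M[R]_(m, n)) (a b : R)
    (y : 'cV_m) (x : 'cV_n) :
  expected_time M (a *: y) (b *: x) = a * b * expected_time M y x.
Proof.
rewrite /expected_time.
have -> : (a *: y)^T = a *: y^T by apply/matrixP => i j; rewrite !mxE.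
by rewrite -!scalemxAl -scalemxAr scalerA mxE.
Qed.

End MatrixOrder.

(* Induction on the rows, after Bartl: if a solution [x0] for the rows of [A]
   violates the extra row [a], normalised to [a x0 = 1], apply the induction
   hypothesis to [A] and [c] precomposed with the projection [1 - x0 a] onto the
   kernel of [a]. *)
Lemma farkas (R : realFieldType) (m n : nat) (A : 'M[R]_(m, n)) (c : 'rV[R]_n) :
  (exists2 x : 'cV[R]_n, mx_le (A *m x) 0 & 0 < (c *m x) 0 0) \/
  (exists2 l : 'rV[R]_m, mx_le 0 l & c = l *m A).
Proof.
elim: m A c => [|m IHm] A c.
  (* Without rows every vector is admissible: [c^T] works because [c *m c^T] is a sum of squares,
     unless [c = 0], which is the empty combination. *)
  have [->|/rV0Pn[j cj_neq0]] := eqVneq c 0.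
    by right; exists 0 => [i j|]; rewrite ?mul0mx ?mxE.
  left; exists c^T => [[]//|]; rewrite mxE (bigD1 j) //= ltr_pwDl //.
    by rewrite mxE -expr2 exprn_even_gt0.
  by apply: sumr_ge0 => k _; rewrite mxE -expr2 sqr_ge0.
rewrite -[m.+1]/(1 + m)%N in A *.
pose a := usubmx A; pose B := dsubmx A.
have defA : A = col_mx a B by rewrite vsubmxK.
have cols (x : 'cV[R]_n) :
    (a *m x) 0 0 <= 0 -> mx_le (B *m x) 0 -> mx_le (A *m x) 0.
  move=> ax Bx; rewrite defA mul_col_mx -[X in mx_le _ X]col_mx0.
  by apply/mx_le_col_mx; split=> // i j; rewrite !ord1 [X in _ <= X]mxE.
have rows (d : 'rV[R]_1) (l : 'rV[R]_m) :
    0 <= d 0 0 -> mx_le 0 l -> mx_le 0 (row_mx d l).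
  move=> d_ge0 l_ge0; rewrite -row_mx0.
  by apply/mx_le_row_mx; split=> // i j; rewrite !ord1 mxE.
have [[x0 Bx0 cx0]|[l l_ge0 ->]] := IHm B c; last first.
  right; exists (row_mx 0 l); first by apply: rows; rewrite // mxE.
  by rewrite [in RHS]defA mul_row_col mul0mx add0r.
have [ax0|ax0] := leP ((a *m x0) 0 0) 0; first by left; exists x0; auto.
pose x1 := ((a *m x0) 0 0)^-1 *: x0.
have ax1 : a *m x1 = 1%:M.
  rewrite -scalemxAr; apply/matrixP => i j.
  by rewrite !ord1 [LHS]mxE [RHS]mxE eqxx mulVf ?gt_eqF.
have Bx1 : mx_le (B *m x1) 0.
  move=> i j; rewrite -scalemxAr [X in X <= _]mxE.
  rewrite [X in _ <= X]mxE pmulr_rle0 ?invr_gt0 //.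
  by have := Bx0 i j; rewrite [X in _ <= X]mxE.
have cx1 : 0 < (c *m x1) 0 0.
  by rewrite -scalemxAr mxE mulr_gt0 ?invr_gt0.
pose P : 'M[R]_n := 1%:M - x1 *m a.
have [[x Bx cx]|[l l_ge0 cP]] := IHm (B *m P) (c *m P).
  (* Since [a *m P = 0], the point [P *m x] meets the extra row with equality. *)
  left; exists (P *m x); last by rewrite mulmxA.
  apply: cols; last by rewrite mulmxA.
  by rewrite mulmxA mulmxBr mulmx1 mulmxA ax1 mul1mx subrr mul0mx mxE.
(* Expanding [c *m P = l *m (B *m P)] gives [c = d *m a + l *m B] with this [d], which is
   nonnegative because [c *m x1 > 0] and [l *m (B *m x1) <= 0]. *)
pose d : 'rV[R]_1 := c *m x1 - l *m (B *m x1).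
right; exists (row_mx d l).
  apply: rows => //; rewrite mxE [X in _ + X]mxE subr_ge0.
  apply: le_trans (ltW cx1); have := mx_le_mul2l l_ge0 Bx1 0 0.
  by rewrite mulmx0 [X in _ <= X]mxE.
rewrite [in RHS]defA mul_row_col mulmxBl.
move: cP; rewrite !mulmxBr !mulmx1 !mulmxA => cP.
by rewrite addrAC -addrA -cP addrC subrK.
Qed.

Section Duality.

Variables (R : realFieldType) (m n : nat) (M : 'M[R]_(m, n)).

(** Pairing [M *m x >= 1] with [y >= 0] gives the left bound; pairing the transpose of
    [M^T *m y <= 1] with [x >= 0] gives the right one. *)
Lemma weak_duality y x : P3_feasible M y -> P4_feasible M x ->
  dot_ones y <= expected_time M y x <= dot_ones x.
Proof.
move=> [My y_ge0] [Mx x_ge0]; rewrite /expected_time; apply/andP; split.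
  by rewrite -mulmxA; apply: mx_le_mul2l Mx 0 0; apply: mx_le_tr0.
rewrite dot_onesC; apply: mx_le_mul2r => //.
by have := mx_le_tr My; rewrite trmx_mul trmxK.
Qed.

Lemma strong_duality y : P3_optimal M y ->
  exists2 x, P4_feasible M x & dot_ones x <= dot_ones y.
Proof.
move=> [[My y_ge0] y_max].
(* The system [S *m (u, t) <= 0] homogenises the first program, with [- t] as scale:
   [M^T *m u <= - t], [u >= 0], [t <= 0]. The form [c] measures the gain of [u] over [- t] times the
   optimal value. *)
pose S : 'M[R]_(n + (m + 1), m + 1) :=
  col_mx (row_mx M^T (const_mx 1)) (block_mx (- 1%:M) 0 0 1%:M).
pose c : 'rV[R]_(m + 1) := row_mx (const_mx 1) (dot_ones y)%:M.
have [[z Sz cz]|[l l_ge0 cE]] := farkas S c.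
  (* A violating ray [(u, t)] with [t <= 0] makes [(y + u) / (1 - t)] a strictly
     better feasible point. *)
  pose u := usubmx z; pose t := dsubmx z 0 0.
  have zE : z = col_mx u t%:M by rewrite -mx11_scalar vsubmxK.
  move: Sz cz; rewrite /S /c zE mul_col_mx mul_row_col mul_block_col.
  rewrite mul_row_col !mul0mx addr0 add0r mulNmx !mul1mx.
  rewrite -[X in mx_le _ X]col_mx0 => /mx_le_col_mx[Mu'].
  rewrite -[X in mx_le _ X]col_mx0 => /mx_le_col_mx[u_le0 t_le] cz.
  have Mu i : (M^T *m u) i 0 + t <= 0.
    by have := Mu' i 0; rewrite mxE mul_mx_scalar !mxE mulr1.
  have u_ge0 i : 0 <= u i 0 by have := u_le0 i 0; rewrite !mxE oppr_le0.
  have t_le0 : t <= 0 by have := t_le 0 0; rewrite !mxE eqxx.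
  have val_gt0 : 0 < dot_ones u + dot_ones y * t.
    move: cz; rewrite mxE -scalar_mxM [X in _ + X]mxE eqxx mulr1n.
    by rewrite -trmx_const -dot_onesC.
  (* Adding [y] keeps the denominator positive even for [t = 0], when [u] is an improving direction
     of recession. *)
  have t1_gt0 : 0 < 1 - t by rewrite subr_gt0 (le_lt_trans t_le0).
  suff /y_max : P3_feasible M ((1 - t)^-1 *: (y + u)).
    rewrite dot_onesZ dot_onesD mulrC ler_pdivrMr // mulrBr mulr1 lerD2l.
    by rewrite -subr_ge0 -opprD addrC oppr_ge0 leNgt val_gt0.
  split=> i j; rewrite (ord1 j).
    rewrite -scalemxAr mxE [X in _ <= X]mxE mulrC ler_pdivrMr // mul1r.
    rewrite mulmxDr mxE lerD //; last by rewrite -subr_le0 opprK.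
    by have := My i 0; rewrite [X in _ <= X]mxE.
  rewrite mxE [X in _ <= X]mxE [X in _ * X]mxE.
  rewrite mulr_ge0 ?invr_ge0 ?(ltW t1_gt0) // addr_ge0 //.
  by have := y_ge0 i 0; rewrite mxE.
(* By blocks, [c = l *m S] says that [s] is the surplus of [M *m x] over 1 and [w] the gap
   [dot_ones y - dot_ones x]; both are nonnegative. *)
pose x := (lsubmx l)^T; pose s := lsubmx (rsubmx l); pose w := rsubmx (rsubmx l).
have lE : l = row_mx x^T (row_mx s w) by rewrite trmxK !hsubmxK.
move: cE; rewrite /c lE /S mul_row_col mul_mx_row mul_row_block.
rewrite !mulmx0 addr0 add0r mulmxN !mulmx1 add_row_mx.
case/eq_row_mx => oneE valE.
move: l_ge0; rewrite lE -row_mx0 => /mx_le_row_mx[x_ge0].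
rewrite -row_mx0 => /mx_le_row_mx[s_ge0 w_ge0].
exists x.
  split=> [i j|]; last by rewrite -[x]trmxK; apply: mx_le_tr0.
  rewrite (ord1 j); have := congr1 (fun r : 'rV_m => r 0 i) oneE.
  rewrite -trmx_mul [LHS]mxE [RHS]mxE [X in X + _]mxE [X in _ + X]mxE => oneEi.
  by rewrite [X in X <= _]mxE oneEi gerBl; have := s_ge0 0 i; rewrite mxE.
have := congr1 (fun r : 'rV_1 => r 0 0) valE.
rewrite [LHS]mxE eqxx mulr1n [RHS]mxE => ->.
by rewrite /dot_ones lerDl; have := w_ge0 0 0; rewrite mxE.
Qed.

(** At [x = 0] any row would read [1 <= 0]. In the game, the existence of a path provides a row. *)
Lemma dot_ones_P4_gt0 x : (0 < m)%N -> P4_feasible M x -> 0 < dot_ones x.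
Proof.
move=> m_gt0 [Mx x_ge0]; apply: dot_ones_gt0 => //; apply/eqP => x0.
by have := Mx (Ordinal m_gt0) 0; rewrite x0 mulmx0 !mxE ler10.
Qed.

Lemma mixed_strategy_normalize k (v : 'cV[R]_k) :
  mx_le 0 v -> 0 < dot_ones v -> mixed_strategy ((dot_ones v)^-1 *: v).
Proof.
move=> v_ge0 v_gt0; split=> [i j|].
  rewrite !mxE mulr_ge0 ?invr_ge0 ?(ltW v_gt0) //.
  by have := v_ge0 i j; rewrite mxE.
by rewrite -dot_onesE dot_onesZ mulVf ?gt_eqF.
Qed.

Lemma nash_of_optimal yhat xhat (y := (dot_ones yhat)^-1 *: yhat)
    (x := (dot_ones xhat)^-1 *: xhat) (T := expected_time M y x) :
  (0 < m)%N -> P3_optimal M yhat -> P4_optimal M xhat ->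
  [/\ nash_equilibrium M y x, dot_ones yhat = dot_ones xhat
    & dot_ones xhat = 1 / T].
Proof.
move=> m_gt0 yP [xF x_min]; have [yF _] := yP.
have [x' x'F x'_le] := strong_duality yP.
have /andP[le_yT le_Tx] := weak_duality yF xF.
have eq_mu : dot_ones yhat = dot_ones xhat.
  apply/eqP; rewrite eq_le (le_trans le_yT le_Tx) /=.
  exact: le_trans (x_min _ x'F) x'_le.
have mu_gt0 := dot_ones_P4_gt0 m_gt0 xF.
have time_hat : expected_time M yhat xhat = dot_ones xhat.
  by apply/eqP; rewrite eq_le le_Tx -eq_mu le_yT.
(* Both normalisations divide by the common value [mu], so [T = mu / mu ^ 2]. *)
have TE : T = (dot_ones xhat)^-1.
  by rewrite /T expected_timeZ time_hat eq_mu mulfVK ?gt_eqF.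
have [[My y_ge0] [Mx x_ge0]] := (yF, xF).
have sum1 k (v : 'cV[R]_k) : mixed_strategy v -> dot_ones v = 1.
  by case=> _; rewrite dot_onesE.
split=> //; last by rewrite TE div1r invrK.
split.
- by apply: mixed_strategy_normalize; rewrite ?eq_mu.
- exact: mixed_strategy_normalize.
(* Only [xhat] is rescaled here; the claim becomes [1 <= expected_time M y' xhat], where 1 is the
   total weight of [y']. *)
- move=> y' y'P; rewrite -/T TE -[y']scale1r expected_timeZ mul1r.
  rewrite ler_peMr ?invr_ge0 ?(ltW mu_gt0) // -(sum1 _ _ y'P).
  rewrite /expected_time -mulmxA; apply: mx_le_mul2l Mx 0 0.
  by apply: mx_le_tr0; case: y'P.
- move=> z zP; rewrite -/T TE -[z]scale1r expected_timeZ mulr1 eq_mu.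
  rewrite ler_piMr ?invr_ge0 ?(ltW mu_gt0) // -(sum1 _ _ zP) dot_onesC.
  apply: mx_le_mul2r; first by case: zP.
  by have := mx_le_tr My; rewrite trmx_mul trmxK.
Qed.

End Duality.

Theorem proposition1 (R : realFieldType) (V : finType) (edge : rel V)
    (time : V -> V -> R) (p : V -> R) (orig dest : V)
    (time_gt0 : forall u v : V, edge u v -> 0 < time u v)
    (p_prob : forall n : V, 0 <= p n <= 1)
    (orig_dest : orig != dest)
    (paths_neq0 : simple_paths edge orig dest != set0)
    (yhat : 'cV[R]_#|simple_paths edge orig dest|) (xhat : 'cV[R]_#|V|) :
  let M := delivery_time_matrix edge time p orig dest in
  P3_optimal M yhat ->
  P4_optimal M xhat ->
  let y := (dot_ones yhat)^-1 *: yhat in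
  let x := (dot_ones xhat)^-1 *: xhat in
  let T := expected_time M y x in
  [/\ nash_equilibrium M y x, dot_ones yhat = dot_ones xhat & dot_ones xhat = 1 / T].
Proof. by move=> M; apply: nash_of_optimal; rewrite card_gt0. Qed.
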